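(* Let $\Omega\subseteq\mathbb{R}^n$ be open, let $u\in\mathcal{E}^C(\Omega)$ and let $\mathcal{J}:=\{I_0^{\mathrm{d}}(\Omega)\}$. Then: (i) $u\in\mathcal{E}_M^C(\Omega)$ if and only if $\forall K\Subset\Omega\ \forall\alpha\in\mathbb{N}^n\ \exists N\in\mathbb{N}:\ \sup_{x\in K}|\partial^\alpha u_\varepsilon(x)|=O_{\mathcal{J}}(\underline{\varepsilon}^{-N})$ as $\varepsilon\in\mathbb{I}^{\mathrm{d}}(\Omega)$; (ii) if $u\in\mathcal{E}_M^C(\Omega)$, then $u\in\mathcal{N}^C(\Omega)$ if and only if $\forall K\Subset\Omega\ \forall\alpha\in\mathbb{N}^n\ \forall m\in\mathbb{N}:\ \sup_{x\in K}|\partial^\alpha u_\varepsilon(x)|=O(\underline{\varepsilon}^{m})$ as $\varepsilon\in\mathbb{I}^{\mathrm{d}}(\Omega)$.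
   Context: $\mathbb{N}=\{0,1,2,\dots\}$, $n\ge1$; $K\Subset\Omega$ means $K$ is a compact subset of $\Omega$. For $\varphi\in\mathcal{D}(\mathbb{R}^n)$, $r>0$: $(r\odot\varphi)(y):=r^{-n}\varphi(y/r)$. $\mathcal{A}_0:=\{\varphi\in\mathcal{D}(\mathbb{R}^n)\mid\int\varphi=1\}$, $\mathcal{A}_q:=\{\varphi\in\mathcal{A}_0\mid\int x^\alpha\varphi(x)\,dx=0\ \forall\, 1\le|\alpha|\le q\}$. $U(\Omega):=\{(\varphi,x)\in\mathcal{A}_0\times\Omega\mid\mathrm{supp}(\varphi)\subseteq\Omega-x\}$. Smoothness: smoothness for the infinite-dimensional spaces is in the usual diffeological/convenient sense. A map $p$ from $(0,1]\times\Omega$, or from an open subset of some $\mathbb{R}^k$, into $\mathcal{A}_q$ is smooth iff $(t,y)\mapsto p(t)(y)$ is smooth and, locally in $t$, the supports of $p(t)$ lie in a common compact set. A function $R:U(\Omega)\to\mathbb{R}$ is smooth iff $R\circ p$ is smooth for every smooth map $p$ from an open subset of some $\mathbb{R}^k$ into $U(\Omega)\subseteq\mathcal{A}_0\times\Omega$. $\mathcal{E}^C(\Omega):=\mathcal{C}^\infty(U(\Omega),\mathbb{R})$. $\mathcal{C}^\infty_{\mathrm{b}}((0,1]\times\Omega,\mathcal{A}_q)$ is the set of $\varphi\in\mathcal{C}^\infty((0,1]\times\Omega,\mathcal{A}_q)$ such that for every $K\Subset\Omega$ there is a bounded $B\subseteq\mathbb{R}^n$ with $\mathrm{supp}[\partial^\alpha\varphi(r,x)]\subseteq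 B$ for all $\alpha\in\mathbb{N}^n$, $r\in(0,1]$, $x\in K$. It is identified with $\mathcal{C}^\infty_{\mathrm{b}}((0,1],\mathcal{C}^\infty(\Omega,\mathcal{A}_q))$ (smooth maps $r\mapsto\varphi_r\in\mathcal{C}^\infty(\Omega,\mathcal{A}_q)$ with the same boundedness condition) via $\varphi_r(x)=\varphi(r,x)$. $R\in\mathcal{E}^C_M(\Omega)$ iff $R\in\mathcal{E}^C(\Omega)$ and $\forall K\Subset\Omega\,\forall\alpha\in\mathbb{N}^n\,\exists N\in\mathbb{N}\,\forall\varphi\in\mathcal{C}^\infty_{\mathrm{b}}((0,1]\times\Omega,\mathcal{A}_0)$: $\sup_{x\in K}|\partial_x^\alpha R(r\odot\varphi(r,x),x)|=O(r^{-N})$ as $r\to0^+$. $R\in\mathcal{N}^C(\Omega)$ iff $R\in\mathcal{E}^C_M(\Omega)$ and $\forall K\Subset\Omega\,\forall\alpha\in\mathbb{N}^n\,\forall m\in\mathbb{N}\,\exists q\in\mathbb{N}\,\forall\varphi\in\mathcal{C}^\infty_{\mathrm{b}}((0,1]\times\Omega,\mathcal{A}_q)$: $\sup_{x\in K}|\partial_x^\alpha R(r\odot\varphi(r,x),x)|=O(r^{m})$ as $r\to0^+$. Index structure: $I_q^{\mathrm{d}}(\Omega):=(0,1]\times\mathcal{C}^\infty_{\mathrm{b}}((0,1],\mathcal{C}^\infty(\Omega,\mathcal{A}_q))$; $\mathbb{I}^{\mathrm{d}}(\Omega)=(I^{\mathrm{d}}(\Omega),\le,\mathcal{I}^{\mathrm{d}}(\Omega))$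 with $I^{\mathrm{d}}(\Omega):=I_0^{\mathrm{d}}(\Omega)$, $\mathcal{I}^{\mathrm{d}}(\Omega):=\{I_q^{\mathrm{d}}(\Omega)\mid q\in\mathbb{N}\}$, and $(r,\varphi)\le(s,\psi)$ iff $\varphi=\psi$ and $r\le s$. For $\varepsilon=(r,\varphi)\in I^{\mathrm{d}}(\Omega)$: $\underline\varepsilon:=r$, $\mathrm{ev}_\varepsilon(x):=(r\odot\varphi_r(x),x)$ and $u_\varepsilon:=u\circ\mathrm{ev}_\varepsilon$ for $u\in\mathcal{E}^C(\Omega)$. Big-O: put $A_{\le e}:=\{\varepsilon\in A\mid\varepsilon\le e\}$. For a nonempty $\mathcal{J}\subseteq\mathcal{I}^{\mathrm{d}}(\Omega)$, $x_\varepsilon=O_{\mathcal{J}}(y_\varepsilon)$ means: there is $A\in\mathcal{J}$ such that for all $a\in A$ there are $H>0$ and $\varepsilon_0\in A_{\le a}$ with $|x_\varepsilon|\le H|y_\varepsilon|$ for all $\varepsilon\in A_{\le\varepsilon_0}$. $O$ without subscript is $O_{\mathcal{J}}$ with $\mathcal{J}=\mathcal{I}^{\mathrm{d}}(\Omega)$. Convention: for given $K\Subset\Omega$ and $\varphi$, $(r\odot\varphi_r(x),x)\in U(\Omega)$ for all $x$ in a neighbourhood of $K$ once $r$ is small enough; the expressions above are considered for such $r$ only, and the values assigned to the suprema for other $r$ are irrelevant. *)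

(* Defs.v *)
From HB Require Import structures.
From mathcomp Require Import all_boot all_order all_algebra.
From mathcomp Require Import all_classical all_reals all_analysis.

Set Implicit Arguments.
Unset Strict Implicit.
Unset Printing Implicit Defensive.

Import Order.TTheory GRing.Theory Num.Theory.
Import numFieldNormedType.Exports.

Local Open Scope classical_set_scope.
Local Open Scope ring_scope.

(* Points of R^n are row vectors. Maps that the mathematics defines on a subset
   of R^k are total functions here; only their values on that subset matter. *)

Fixpoint iterD (R : realType) (E F : normedModType R) (l : seq E) (f : E -> F) :
    E -> F :=
  if l is v :: l' then (fun x => 'D_v (iterD l' f) x) else f.

(* C^oo on an open set V of a finite-dimensional space: all iterated directional
   (hence all iterated partial) derivatives exist and are continuous on V. *)
Definition smooth_on (R : realType) (E F : normedModType R) (V : set E)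
    (f : E -> F) : Prop :=
  forall (l : seq E) (x : E), V x ->
    {for x, continuous (iterD l f)} /\
    forall v : E, derivable (iterD l f) x v.

(* Smoothness on an arbitrary subset X of a finite-dimensional space, for the
   subspace diffeology: f is smooth along every smooth map p from an open subset
   of some R^k into X. For X open this is smooth_on X f, by the chain rule; the
   general case is needed for (0,1] x Omega, which is not open. *)
Definition dsmooth (R : realType) (E F : normedModType R) (X : set E)
    (f : E -> F) : Prop :=
  forall (k : nat) (V : set 'rV[R]_k) (p : 'rV[R]_k -> E),
    open V -> smooth_on V p -> p @` V `<=` X -> smooth_on V (f \o p).

Definition multiindex (n : nat) := {ffun 'I_n -> nat}.

Definition mdeg (n : nat) (a : multiindex n) : nat := (\sum_(i < n) a i)%N.

Definition monom (R : realType) (n : nat) (a : multiindex n) (x : 'rV[R]_n) : R :=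
  \prod_(i < n) x 0 i ^+ a i.

Definition pderiv (R : realType) (n : nat) (a : multiindex n)
    (f : 'rV[R]_n -> R) : 'rV[R]_n -> R :=
  iterD (flatten [seq nseq (a i) (delta_mx 0 i : 'rV[R]_n) | i <- enum 'I_n]) f.

(* Lebesgue integral over R^n as an n-fold iterated integral, which is the same
   by Fubini's theorem for the continuous compactly supported integrands below. *)
Fixpoint integralRn (R : realType) (n : nat) : ('rV[R]_n -> R) -> R :=
  match n with
  | 0%N => fun f => f 0
  | m.+1 => fun f => \int[lebesgue_measure]_(t in [set: R])
              integralRn (fun y : 'rV[R]_m => f (row_mx (const_mx t : 'rV_1) y))
  end.

Definition supp (R : realType) (n : nat) (phi : 'rV[R]_n -> R) : set 'rV[R]_n :=
  closure [set y | phi y != 0].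

Definition test_fun (R : realType) (n : nat) : set ('rV[R]_n -> R) :=
  [set phi | smooth_on setT phi /\ compact (supp phi)].

(* The moment condition is vacuous for q = 0, so that calA R n 0 is A_0. *)
Definition calA (R : realType) (n q : nat) : set ('rV[R]_n -> R) :=
  [set phi | [/\ test_fun phi, integralRn phi = 1 &
    forall a : multiindex n, (1 <= mdeg a <= q)%N ->
      integralRn (fun x => monom a x * phi x) = 0]].

Definition smooth_into_calA (R : realType) (n q : nat) (E : normedModType R)
    (X : set E) (p : E -> 'rV[R]_n -> R) : Prop :=
  [/\ forall t, X t -> calA q (p t),
      dsmooth (X `*` [set: 'rV[R]_n]) (fun ty => p ty.1 ty.2) &
      forall t, X t -> exists2 L : set 'rV[R]_n, compact L &
        \forall s \near t, X s -> supp (p s) `<=` L].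

Definition odot (R : realType) (n : nat) (r : R) (phi : 'rV[R]_n -> R) :
    'rV[R]_n -> R :=
  fun y => r ^- n * phi (r^-1 *: y).

Definition UOmega (R : realType) (n : nat) (Omega : set 'rV[R]_n) :
    set (('rV[R]_n -> R) * 'rV[R]_n) :=
  [set px | [/\ calA 0 px.1, Omega px.2 &
    supp px.1 `<=` [set y | Omega (y + px.2)]]].

Definition EC (R : realType) (n : nat) (Omega : set 'rV[R]_n) :
    set (('rV[R]_n -> R) * 'rV[R]_n -> R) :=
  [set u | forall (k : nat) (V : set 'rV[R]_k)
      (p1 : 'rV[R]_k -> 'rV[R]_n -> R) (p2 : 'rV[R]_k -> 'rV[R]_n),
    open V -> smooth_into_calA 0 V p1 -> smooth_on V p2 ->
    (forall t, V t -> UOmega Omega (p1 t, p2 t)) ->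
    smooth_on V (fun t => u (p1 t, p2 t))].

Definition I01 (R : realType) : set R := `]0, 1]%classic.

(* C^oo_b((0,1] x Omega, A_q). Elements are required to vanish off (0,1] x Omega,
   so that = between them is equality of maps on (0,1] x Omega. *)
Definition Cb (R : realType) (n q : nat) (Omega : set 'rV[R]_n) :
    set (R * 'rV[R]_n -> 'rV[R]_n -> R) :=
  [set phi |
    [/\ smooth_into_calA (E := (R * 'rV[R]_n)%type) q (@I01 R `*` Omega) phi,
        forall K : set 'rV[R]_n, compact K -> K `<=` Omega ->
          exists2 B : set 'rV[R]_n, bounded_set B &
            forall (a : multiindex n) (r : R) (x : 'rV[R]_n), I01 r -> K x ->
              supp (fun y => pderiv a (fun z => phi (r, z) y) x) `<=` B &
        forall rx, ~ (@I01 R `*` Omega) rx -> phi rx = cst 0]].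

(* C^oo_b((0,1], C^oo(Omega, A_q)), identified with the previous set through
   phi_r x = phi (r, x). *)
Definition Cb_curry (R : realType) (n q : nat) (Omega : set 'rV[R]_n) :
    set (R -> 'rV[R]_n -> 'rV[R]_n -> R) :=
  [set phi | Cb q Omega (fun rx => phi rx.1 rx.2)].

(* The real-valued sup is 0 on sets that are empty or unbounded above. In the
   uses below the set is bounded for small r, when the function is smooth near
   K, and only those r matter for the asymptotics; for K empty the value is 0. *)
Definition supK (R : realType) (n : nat) (K : set 'rV[R]_n)
    (f : 'rV[R]_n -> R) : R :=
  sup [set `|f x| | x in K].

Definition ECM (R : realType) (n : nat) (Omega : set 'rV[R]_n) :
    set (('rV[R]_n -> R) * 'rV[R]_n -> R) :=
  [set u | EC Omega u /\
    forall K : set 'rV[R]_n, compact K -> K `<=` Omega ->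
    forall a : multiindex n, exists N : nat,
    forall phi, Cb 0 Omega phi ->
      (fun r : R => supK K (pderiv a (fun x => u (odot r (phi (r, x)), x))))
        =O_ (0^'+) (fun r : R => r ^- N)].

Definition NC (R : realType) (n : nat) (Omega : set 'rV[R]_n) :
    set (('rV[R]_n -> R) * 'rV[R]_n -> R) :=
  [set u | ECM Omega u /\
    forall K : set 'rV[R]_n, compact K -> K `<=` Omega ->
    forall (a : multiindex n) (m : nat), exists q : nat,
    forall phi, Cb q Omega phi ->
      (fun r : R => supK K (pderiv a (fun x => u (odot r (phi (r, x)), x))))
        =O_ (0^'+) (fun r : R => r ^+ m)].

(* Ambient type of the indices eps = (r, phi). *)
Definition index (R : realType) (n : nat) : Type :=
  (R * (R -> 'rV[R]_n -> 'rV[R]_n -> R))%type.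

Definition Id (R : realType) (n q : nat) (Omega : set 'rV[R]_n) :
    set (index R n) :=
  @I01 R `*` Cb_curry q Omega.

Definition calId (R : realType) (n : nat) (Omega : set 'rV[R]_n) :
    set (set (index R n)) :=
  [set Id q Omega | q in [set: nat]].

Definition index_le (R : realType) (n : nat) (e1 e2 : index R n) : Prop :=
  e1.2 = e2.2 /\ e1.1 <= e2.1.

Definition index_r (R : realType) (n : nat) (e : index R n) : R := e.1.

Definition index_ev (R : realType) (n : nat) (e : index R n) (x : 'rV[R]_n) :
    ('rV[R]_n -> R) * 'rV[R]_n :=
  (odot e.1 (e.2 e.1 x), x).

Definition u_at (R : realType) (n : nat) (u : ('rV[R]_n -> R) * 'rV[R]_n -> R)
    (e : index R n) : 'rV[R]_n -> R :=
  u \o index_ev e.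

Definition below (R : realType) (n : nat) (A : set (index R n))
    (e : index R n) : set (index R n) :=
  [set e' | A e' /\ index_le e' e].

Definition index_bigO (R : realType) (n : nat) (J : set (set (index R n)))
    (x y : index R n -> R) : Prop :=
  exists2 A, J A &
    forall a, A a -> exists H : R, exists e0 : index R n,
      [/\ 0 < H, below A a e0 &
          forall e, below A e0 e -> `|x e| <= H * `|y e|].

(* Main.v *)
Require Import Defs.
From HB Require Import structures.
From mathcomp Require Import all_boot all_order all_algebra.
From mathcomp Require Import all_classical all_reals all_analysis.

Import Order.TTheory GRing.Theory Num.Theory.
Import numFieldNormedType.Exports.

Local Open Scope classical_set_scope.
Local Open Scope ring_scope.

(** An index [(r, phi)] lies below [(s, psi)] exactly when [phi = psi] and
    [r <= s], so the order never compares different test objects: the part of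
    [Id q Omega] below an index is an initial segment of the ray
    [(0, 1] * {phi}]. Hence being big-O along [Id q Omega] splits into separate
    conditions, one for each [phi], and each of them is the usual big-O as
    [r] tends to [0] from the right ([bigO_indexP]).
    Moreover [ev_(r, phi) x] is [(odot r (phi_r x), x)], so that the function
    estimated on the index side is, after uncurrying [phi], the one estimated in
    the definitions of [ECM] and [NC] ([bigO_CbP]). Since the existential
    quantifiers on [N], respectively on [q], precede the one on [phi] on both
    sides, both equivalences follow. *)

Lemma bigO_right0P (R : realType) (f g : R -> R) :
  f =O_ (0^'+) g <->
  exists H d : R, [/\ 0 < H, 0 < d &
    forall r, 0 < r -> r <= d -> `|f r| <= H * `|g r|].
Proof.
split=> [/eqO_exP[H H0 [e /= e0 eH]]|[H [d [H0 d0 Hd]]]].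
- exists H, (e / 2); split=> //; first by rewrite divr_gt0.
  move=> r r0 re; apply: eH => //=; rewrite sub0r normrN gtr0_norm //.
  by rewrite (le_lt_trans re) // ltr_pdivrMr // ltr_pMr // ltr1n.
- apply/eqO_exP; exists H => //; exists d => //= r /=.
  rewrite sub0r normrN => rd r0; apply: Hd => //.
  by rewrite (le_trans (ler_norm r)) // ltW.
Qed.

(** Since each index set [Id q Omega] contains all of [(0, 1] * {phi}], the
    starting indices [a] can be moved to [(1, phi)], and the threshold [e0] can
    be taken below any given [a]. *)
Lemma bigO_indexP (R : realType) (n q : nat) (Omega : set 'rV[R]_n)
    (F : Defs.index R n -> R) (g : R -> R) :
  (forall a, Id q Omega a -> exists H : R, exists e0 : Defs.index R n,
    [/\ 0 < H, below (Id q Omega) a e0 &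
        forall e, below (Id q Omega) e0 e -> `|F e| <= H * `|g (index_r e)|])
  <->
  forall phi, Cb_curry q Omega phi -> (fun r => F (r, phi)) =O_ (0^'+) g.
Proof.
have I01E (r : R) : I01 r <-> 0 < r /\ r <= 1.
  by rewrite /I01 /= in_itv /=; split=> [/andP[]|[-> ->]].
split=> [idO phi Cphi|phiO [s phi] [/= /I01E[s0 s1] Cphi]].
- have [|H [[d psi] [H0 [[/I01E /= [d0 d1] _] [/= -> _]] Hd]]] := idO (1, phi).
    by split=> //; apply/I01E; split.
  apply/bigO_right0P; exists H, d; split=> // r r0 rd.
  apply: (Hd (r, phi)); split; split=> //=.
  by apply/I01E; split=> //; exact: le_trans d1.
- have /bigO_right0P[H [d [H0 d0 Hd]]] := phiO phi Cphi.
  have ms : Num.min s d <= s by rewrite ge_min lexx.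
  exists H, (Num.min s d, phi); split=> //.
    split; split=> //=; apply/I01E.
    by rewrite lt_min s0 d0; split=> //; exact: le_trans s1.
  move=> [r psi] [[/= /I01E[r0 _] _] [/= -> rm]].
  by apply: Hd => //; rewrite (le_trans rm) // ge_min lexx orbT.
Qed.

(** A growth estimate along a single index set [Id q Omega] is the estimate over
    all test objects of order [q] in the definitions of [ECM] and [NC]; the
    scale [g] is [r ^- N] or [r ^+ m]. *)
Lemma bigO_CbP (R : realType) (n q : nat) (Omega K : set 'rV[R]_n)
    (u : ('rV[R]_n -> R) * 'rV[R]_n -> R) (a : multiindex n) (g : R -> R) :
  index_bigO [set Id q Omega]
    (fun e => supK K (pderiv a (u_at u e))) (fun e => g (index_r e))
  <->
  forall phi, Cb q Omega phi ->
    (fun r : R => supK K (pderiv a (fun x => u (odot r (phi (r, x)), x))))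
      =O_ (0^'+) g.
Proof.
pose F e := supK K (pderiv a (u_at u e)).
split=> [[_ -> /(bigO_indexP _ _ _ _ F g) O] phi Cphi|O].
- apply: (O (fun r x => phi (r, x))); rewrite /Cb_curry /=.
  by have -> : (fun rx => phi (rx.1, rx.2)) = phi by apply/funext => -[].
- exists (Id q Omega) => //; apply/(bigO_indexP _ _ _ _ F g) => phi Cphi.
  exact: (O (fun rx => phi rx.1 rx.2)).
Qed.

Theorem theorem34 (R : realType) (n : nat) (hn : (0 < n)%N)
    (Omega : set 'rV[R]_n) (hOmega : open Omega)
    (u : ('rV[R]_n -> R) * 'rV[R]_n -> R) (hu : EC Omega u) :
  (ECM Omega u <->
    forall K : set 'rV[R]_n, compact K -> K `<=` Omega ->
    forall a : multiindex n, exists N : nat,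
      index_bigO [set Id 0 Omega]
        (fun e => supK K (pderiv a (u_at u e))) (fun e => index_r e ^- N))
  /\
  (ECM Omega u ->
    (NC Omega u <->
      forall K : set 'rV[R]_n, compact K -> K `<=` Omega ->
      forall (a : multiindex n) (m : nat),
        index_bigO (calId Omega)
          (fun e => supK K (pderiv a (u_at u e))) (fun e => index_r e ^+ m))).
Proof.
split; [split=> [[_ uM]|uO]|move=> uM; split=> [[_ uN]|uO]].
- move=> K cK KO a; have [N uN] := uM K cK KO a.
  by exists N; apply/(bigO_CbP _ _ _ _ _ _ _ (fun r => r ^- N)).
- split=> // K cK KO a; have [N uN] := uO K cK KO a.
  by exists N; apply/bigO_CbP.
- move=> K cK KO a m; have [q uq] := uN K cK KO a m.
  have [_ -> bnd] : index_bigO [set Id q Omega]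
      (fun e => supK K (pderiv a (u_at u e))) (fun e => index_r e ^+ m).
    by apply/(bigO_CbP _ _ _ _ _ _ _ (fun r => r ^+ m)).
  by exists (Id q Omega) => //; exists q.
- split=> // K cK KO a m; have [_ [q _ <-] bnd] := uO K cK KO a m.
  by exists q; apply/bigO_CbP; exists (Id q Omega).
Qed.
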